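(* Let $T<2\Delta$. No Total Order Broadcast implementation is $T$-bounded.
   Context: **Model.** Processes exchange messages and are organized in two sets: servers $\Pi$ and clients $\Theta$ (which may be disjoint or overlap). The set $\Pi$ is fixed and known to every correct process, and $n=|\Pi|=5f+1$, where at most $f$ servers are faulty; no assumption is made on the number of faulty clients. Faulty processes are Byzantine: they may deviate arbitrarily from the algorithm, collude and coordinate; the adversary is adaptive (it can choose which processes to compromise based on system and protocol state), can eavesdrop on any link, and no assumption is made on its computational power. Processes that are not faulty are correct. Any two processes communicate via reliable, authenticated, FIFO links (messages are delivered in the order they are sent). Partial synchrony is assumed: the message delay between processes is bounded by an unknown constant $\Delta$ (which includes the duration of any constant-time computing needed to produce a message at the sender or deliver it at the receiver), and the difference between real time and the local time of any process is bounded by an unknown constant $\Psi$. **Total Order Broadcast.** Let $\mathcal M$ be the set of all possible messages. The interface of an instance $tob$ consists of a request $\langle tob.\mathrm{Broadcast}\mid m\in\mathcal M\rangle$, which a correct client uses to broadcast $m$, and an indication $\langle tob.\mathrm{Deliver}\mid\theta\in\Theta, m\in\mathcal M\rangle$, which a correct server uses to deliver $m$ from $\theta$. Correct clients never broadcast the same message twice. Total Order Broadcast ensures: No Duplication: no correct server delivers the same message from the same sender twice. Integrity: a correct server delivers a message $m$ from a correct client $\theta$ only if $\theta$ broadcast $m$. Validity: all messages broadcast by a correct client are eventually delivered by a correct server. Agreement and Total Order: all correct servers eventually deliver the same messages in the same order. A Total Order Broadcast implementation is an algorithm that ensures these properties under the model above. **Good-case assumptions** (on an execution). All processes are correct, local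 computation is instantaneous, and the system is synchronous such that $\Delta$ is known and $\Psi=0$. **$T$-bounded.** Let $\mathcal A$ be an implementation of Total Order Broadcast under the model above. $\mathcal A$ is $T$-bounded if and only if, for every execution of $\mathcal A$ abiding by the good-case assumptions, if a client $\theta$ broadcasts a message $m$ by time $t$, then every server delivers $m$ by time $t+T$. *)

(* Defs.v *)
From mathcomp Require Import all_boot all_order all_algebra.
From mathcomp Require Import reals.

Set Implicit Arguments.
Unset Strict Implicit.
Unset Printing Implicit Defensive.

Import Order.TTheory GRing.Theory Num.Theory.
Local Open Scope ring_scope.

(* - [R] is real time, [P] the type of all processes, [Theta] the clients,
     [Pi] the servers, [M] the broadcastable messages.  [W] is the type of the
     messages that an algorithm exchanges over the links.
   - A process is a state machine.  It takes a step when it receives a message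
     on a link, when (if it is a client) it is asked to broadcast, or when its
     local clock has reached the alarm set in its current state.  A step is a
     single event, with no duration of its own. *)

Definition client (P : finType) (Theta : {set P}) := {x : P | x \in Theta}.

Inductive input (P W M : Type) : Type :=
  | Recv of P & W
  | Bcast of M
  | Wake.
Arguments Wake {P W M}.
Arguments Recv {P W M}.
Arguments Bcast {P W M}.

(* Link messages sent, with their destinations, and messages delivered, with
   their senders, both in order. *)
Record output (P : finType) (Theta : {set P}) (W M : Type) := Output {
  sends : seq (P * W);
  dlvs : seq (client Theta * M)
}.

(* Several initial states are allowed; they may differ, for instance, in the
   contents of a local random tape.  [alg_step p s c x] is the step of process
   [p] in state [s] on input [x] when its local clock shows [c]. *)
Record algorithm (R : realType) (P : finType) (Theta : {set P}) (M : Type) :=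
  Algorithm {
  link_msg : Type;
  local_state : Type;
  alg_init : P -> local_state -> Prop;
  alg_step : P -> local_state -> R -> input P link_msg M ->
             local_state * output Theta link_msg M;
  alarm : P -> local_state -> option R;
  alg_init_ex : forall p, exists s, alg_init p s;
  (* A process receiving no input takes finitely many steps in bounded time:
     if [s k] and [c k] are the state and the local time at the k-th of an
     infinite chain of steps, each handled as soon as its alarm is reached,
     then the local times are unbounded.  Without this, an algorithm could
     have no execution at all. *)
  alg_nonzeno : forall p (s : nat -> local_state) (c : nat -> R),
    (forall k, s k.+1 = (alg_step p (s k) (c k) Wake).1 /\
       exists2 x, alarm p (s k.+1) = Some x & c k.+1 = Num.max (c k) x) ->
    forall B : R, exists k, B < c k
}.

Section Executions.
Variables (R : realType) (P : finType) (Pi Theta : {set P}) (M : eqType).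
Variable A : algorithm R Theta M.

Record action := Action {
  actor : P;
  act_in : input P (link_msg A) M;
  act_out : output Theta (link_msg A) M
}.

(* Events are numbered in an order compatible with real time and causality;
   [None] is an idle event, which only lets time pass. The state [state i p] of
   [p] just before event [i] is meaningful for correct [p] only. *)
Record trace := Trace {
  time : nat -> R;
  event : nat -> option action;
  faulty : {set P};
  clock : P -> R -> R;
  state : nat -> P -> local_state A
}.

Variable e : trace.

Definition correct (p : P) : bool := p \notin faulty e.

(* The items that [g] extracts from the events numbered below [i], in order. *)
Definition log (X : Type) (g : action -> seq X) (i : nat) : seq X :=
  flatten [seq (if event e j is Some a then g a else [::]) | j <- iota 0 i].

Definition sent (p q : P) : nat -> seq (link_msg A) :=
  log (fun a => if actor a == p
                then [seq u.2 | u <- sends (act_out a) & u.1 == q] else [::]).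

Definition received (p q : P) : nat -> seq (link_msg A) :=
  log (fun a => if (actor a == q) then
                  if act_in a is Recv p' w then
                    if p' == p then [:: w] else [::]
                  else [::]
                else [::]).

Definition delivered (s : P) : nat -> seq (client Theta * M) :=
  log (fun a => if actor a == s then dlvs (act_out a) else [::]).

Definition takes (i : nat) (p : P) (x : input P (link_msg A) M) : Prop :=
  exists y, event e i = Some (Action p x y).

Definition broadcasts (i : nat) (theta : client Theta) (m : M) : Prop :=
  takes i (val theta) (Bcast m).

Definition time_diverges : Prop :=
  [/\ 0 <= time e 0%N,
      forall i, time e i <= time e i.+1
    & forall B, exists i, B < time e i].

Definition clocks_within (Psi : R) : Prop :=
  forall p t, `|clock e p t - t| <= Psi.

(* On every link, the messages received are, in the same order, those sent
   earlier (reliable, authenticated, FIFO links), each at most [Delta] later.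
   This binds the links themselves, so it also holds at faulty processes. *)
Definition links_within (Delta : R) : Prop :=
  forall p q i,
    (exists r, sent p q i = received p q i.+1 ++ r) /\
    (exists2 j, time e j <= time e i + Delta
              & (size (sent p q i.+1) <= size (received p q j.+1))%N).

Definition enabled (i : nat) (p : P) (x : input P (link_msg A) M) : Prop :=
  match x with
  | Recv _ _ => True
  | Bcast _ => p \in Theta
  | Wake => exists2 d, alarm p (state e i p) = Some d & d <= clock e p (time e i)
  end.

Definition follows_algorithm (p : P) : Prop :=
  alg_init p (state e 0%N p) /\
  forall i,
    (forall x y, event e i = Some (Action p x y) ->
       enabled i p x /\
       alg_step p (state e i p) (clock e p (time e i)) x = (state e i.+1 p, y)) /\
    ((forall x, ~ takes i p x) -> state e i.+1 p = state e i p).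

(* Local computation is late by at most [lag]: an alarm reached at real time
   [t] has been handled, or replaced by another one, by time [t + lag]. *)
Definition steps_within (lag : R) : Prop :=
  forall p i d t, correct p ->
    alarm p (state e i p) = Some d ->
    (if i is i'.+1 then time e i' else 0) <= t -> d <= clock e p t ->
    exists j, [/\ (i <= j)%N, time e j <= t + lag
                & takes j p Wake \/ alarm p (state e j.+1 p) <> Some d].

Definition no_rebroadcast : Prop :=
  forall theta m i j, correct (val theta) ->
    broadcasts i theta m -> broadcasts j theta m -> i = j.

Definition base_execution (f : nat) : Prop :=
  [/\ (#|faulty e :&: Pi| <= f)%N,
      forall p, correct p -> follows_algorithm p,
      no_rebroadcast
    & time_diverges].

(* [Delta] also bounds the lateness of local computing.  Since [faulty e] is an
   arbitrary set and the actions of its members are unconstrained, this covers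
   colluding, eavesdropping and adaptive adversaries. *)
Definition execution (f : nat) (Delta Psi : R) : Prop :=
  [/\ base_execution f, links_within Delta, steps_within Delta
    & clocks_within Psi].

Definition good_case (f : nat) (Delta : R) : Prop :=
  [/\ base_execution f, faulty e = set0, links_within Delta, steps_within 0
    & clocks_within 0].

Definition no_duplication : Prop :=
  forall s, s \in Pi -> correct s -> forall i, uniq (delivered s i).

Definition integrity : Prop :=
  forall s, s \in Pi -> correct s ->
  forall theta m i, correct (val theta) -> (theta, m) \in delivered s i ->
  exists2 j, (j < i)%N & broadcasts j theta m.

Definition validity : Prop :=
  forall theta m i, correct (val theta) -> broadcasts i theta m ->
  exists s, [/\ s \in Pi, correct s & exists j, (theta, m) \in delivered s j].

(* The (finite or infinite) sequences delivered by any two correct servers are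
   equal: every finite part of one is eventually a prefix of the other. *)
Definition agreement_total_order : Prop :=
  forall s s', s \in Pi -> s' \in Pi -> correct s -> correct s' ->
  forall i, exists j, prefix (delivered s i) (delivered s' j).

Definition total_order_broadcast : Prop :=
  [/\ no_duplication, integrity, validity & agreement_total_order].

Definition delivers_in_time (T : R) : Prop :=
  forall theta m t, (exists2 i, time e i <= t & broadcasts i theta m) ->
  forall s, s \in Pi ->
  exists2 j, time e j <= t + T & (theta, m) \in delivered s j.+1.

End Executions.

Section Implementations.
Variables (R : realType) (P : finType) (Pi Theta : {set P}) (M : eqType).

(* The true bounds on delays and clocks are unknown to the algorithm: the
   properties are required whatever they are. *)
Definition tob_implementation (f : nat) (A : algorithm R Theta M) : Prop :=
  forall (Delta Psi : R) (e : trace A),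
    execution Pi e f Delta Psi -> total_order_broadcast Pi e.

(* Here [Delta] is the delay bound known in the good case: [A] is fixed after
   [Delta], so it may use it. *)
Definition T_bounded (f : nat) (Delta T : R) (A : algorithm R Theta M) : Prop :=
  forall e : trace A, good_case Pi e f Delta -> delivers_in_time Pi e T.

End Implementations.

(* Main.v *)
Require Import Defs.
From mathcomp Require Import all_boot all_order all_algebra.
From mathcomp Require Import reals.
From mathcomp Require Import lra zify.
From Stdlib Require Import ClassicalEpsilon.

(* Let all messages take exactly Delta.  If a client theta broadcasts m at time 0,
   the other processes learn of it at time Delta, and their reactions reach a
   server s1 at time 2 Delta at the earliest.  Hence s1, which delivers m before
   that, does so only because of what theta sent to it before time Delta.
   Consider then a faulty theta which behaves towards s1 as if it had broadcast m,
   and towards everyone else as if it had not: s1 delivers m, and by agreement so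
   does any other correct server s2.  Now s2 cannot distinguish this from theta
   being correct and silent and s1 being faulty, pretending to have received these
   messages; there the delivery of m by s2 contradicts integrity.

   As every delay is Delta > 0, what a process does during the window
   [k Delta, (k+1) Delta[ depends only on its state at k Delta and on what was
   sent to it in the previous window.  Executions are thus built window by window, for each process
   separately, and then merged by sorting on time. *)

Set Implicit Arguments.
Unset Strict Implicit.
Unset Printing Implicit Defensive.

Import Order.TTheory GRing.Theory Num.Theory.
Local Open Scope ring_scope.

(** * Timed lists *)

Section TimedLists.
Variable R : realDomainType.

Definition tle (T : Type) : rel (R * T) := fun x y => x.1 <= y.1.

Lemma tle_total T : total (@tle T).
Proof. by move=> x y; exact: le_total. Qed.

Lemma tle_trans T : transitive (@tle T).
Proof. by move=> x y z; exact: le_trans. Qed.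

Lemma sorted_tle_cons T (x : R * T) l :
  sorted (@tle T) (x :: l) = all (fun y => x.1 <= y.1) l && sorted (@tle T) l.
Proof. by rewrite /= path_sortedE //; exact: tle_trans. Qed.

Lemma sorted_tle_cat T (l l' : seq (R * T)) :
  sorted (@tle T) (l ++ l') =
  [&& sorted (@tle T) l, sorted (@tle T) l' &
      all (fun x => all (fun y => x.1 <= y.1) l') l].
Proof.
elim: l => [|x l IH]; first by rewrite /= andbT.
rewrite cat_cons !sorted_tle_cons IH all_cat /=.
by case: all; case: all; case: sorted; case: sorted; case: all.
Qed.

(** In a sorted list the items up to a given time form a prefix, so counting them gives its length.
    This turns a deadline into an index. *)
Lemma take_count_le T (l : seq (R * T)) t :
  sorted (@tle T) l ->
  take (count (fun x => x.1 <= t) l) l = [seq x <- l | x.1 <= t].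
Proof.
elim: l => [|x l IH] //; rewrite sorted_tle_cons => /andP[hx hl] /=.
case: ifP => xt; first by rewrite add1n /= IH.
have late : count (fun y : R * T => y.1 <= t) l = 0%N.
  apply/eqP; rewrite -leqn0 leqNgt -has_count -all_predC.
  apply: sub_all hx => y /= xy; apply: contraFN xt => yt; exact: le_trans yt.
rewrite add0n late take0; apply/esym/nilP.
by rewrite /nilp size_filter late.
Qed.

(** * Timed items extracted from a list of events *)

Section Items.
Variables (T X : Type).
Implicit Types (g : T -> seq X) (l : seq (R * T)).

(** The time stays attached to what is extracted, so that a link of constant delay becomes a shift
    of times. *)
Definition items g l : seq (R * X) :=
  flatten [seq [seq (x.1, y) | y <- g x.2] | x <- l].

Lemma items_cons g x l :
  items g (x :: l) = [seq (x.1, y) | y <- g x.2] ++ items g l.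
Proof. by []. Qed.

Lemma items_cat g l l' : items g (l ++ l') = items g l ++ items g l'.
Proof. by rewrite /items map_cat flatten_cat. Qed.

Lemma eq_items g g' : g =1 g' -> items g =1 items g'.
Proof. by move=> gg' l; elim: l => //= x l IH; rewrite !items_cons IH gg'. Qed.

Lemma items_nil g l : all (fun x => nilp (g x.2)) l -> items g l = [::].
Proof.
by elim: l => //= x l IH /andP[/nilP gx /IH]; rewrite items_cons gx => ->.
Qed.

Lemma items_filter g (a : pred (R * T)) l :
  (forall x, ~~ a x -> g x.2 = [::]) -> items g (filter a l) = items g l.
Proof.
move=> ga; elim: l => //= x l IH.
by case: ifPn => [_|/ga gx]; rewrite !items_cons IH // gx.
Qed.

(** Sorting is stable, hence it does not rearrange a subsequence that is sorted already, even among
    equal times. Merging several sources thus keeps the order of each. *)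
Lemma items_sort g l :
  sorted (@tle T) [seq x <- l | ~~ nilp (g x.2)] ->
  items g (sort (@tle T) l) = items g l.
Proof.
move=> sl; pose a (x : R * T) := ~~ nilp (g x.2).
have ga x : ~~ a x -> g x.2 = [::] by rewrite negbK => /nilP.
rewrite -(items_filter (sort _ l) ga) -(items_filter l ga).
rewrite (filter_sort (@tle_total T) (@tle_trans T)).
by rewrite (sorted_sort (@tle_trans T)).
Qed.

Lemma filter_items g (P : pred R) l :
  [seq y <- items g l | P y.1] = items g [seq x <- l | P x.1].
Proof.
elim: l => //= x l IH; rewrite items_cons filter_cat IH filter_map /preim /=.
case: ifP => Px; first by rewrite filter_predT items_cons.
by rewrite filter_pred0.
Qed.

Lemma all_items g (P : pred R) l :
  all (fun x => P x.1) l -> all (fun y => P y.1) (items g l).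
Proof.
elim: l => //= x l IH /andP[Px /IH Pl].
rewrite items_cons all_cat Pl andbT all_map.
by rewrite (@eq_all _ _ predT) ?all_predT // => y /=; rewrite Px.
Qed.

Lemma sorted_items g l : sorted (@tle T) l -> sorted (@tle X) (items g l).
Proof.
elim: l => // x l IH; rewrite sorted_tle_cons items_cons sorted_tle_cat.
move=> /andP[xl /IH ->].
have -> /= : sorted (@tle X) [seq (x.1, y) | y <- g x.2].
  elim: (g x.2) => // y s IHs; rewrite map_cons sorted_tle_cons IHs andbT.
  by rewrite all_map (@eq_all _ _ predT) ?all_predT // => z /=; rewrite lexx.
rewrite all_map (@eq_all _ _ predT) ?all_predT // => y /=.
exact: (@all_items g (fun t => x.1 <= t)).
Qed.

Lemma map_snd_items g l :
  [seq y.2 | y <- items g l] = flatten [seq g x.2 | x <- l].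
Proof.
elim: l => //= x l IH; rewrite items_cons map_cat IH -map_comp.
by rewrite (@eq_map _ _ _ id) ?map_id.
Qed.

End Items.

Lemma items_map T T' X (k : T -> T') (g : T' -> seq X) (l : seq (R * T)) :
  items g [seq (x.1, k x.2) | x <- l] = items (g \o k) l.
Proof. by rewrite /items -map_comp. Qed.

(** Serves to recover the part contributed by one process, or by one sender, from a merge over all
    of [P]. *)
Lemma filter_flatten_pick (I : finType) T (F : I -> seq T) (a : pred T) i :
  (forall j, j != i -> [seq x <- F j | a x] = [::]) ->
  [seq x <- flatten [seq F j | j <- enum I] | a x] = [seq x <- F i | a x].
Proof.
move=> Fa; rewrite filter_flatten -map_comp.
have : uniq (enum I) by exact: enum_uniq.
have : i \in enum I by rewrite mem_enum.
elim: (enum I) => //= j s IH; rewrite in_cons => ij /andP[js us].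
have none r : i \notin r -> flatten [seq [seq x <- F j0 | a x] | j0 <- r] = [::].
  elim: r => //= k r IHr; rewrite in_cons negb_or => /andP[ik /IHr ->].
  by rewrite Fa ?cats0 // eq_sym.
case: (eqVneq j i) ij js => [-> _ js|ji]; first by rewrite none ?cats0.
by move=> /= si _; rewrite Fa // IH.
Qed.

End TimedLists.
Arguments tle {R T}.
(** * Infinite sequences cut into time windows *)

Section Windows.
Variables (R : realType) (T : Type) (x0 : T) (D : R) (win : nat -> seq (R * T)).

Definition in_window (k : nat) (t : R) : bool := k%:R * D <= t < k.+1%:R * D.

Definition windowed (k : nat) X (l : seq (R * X)) : bool :=
  sorted tle l && all (fun x => in_window k x.1) l.

Hypothesis D_gt0 : 0 < D.
Hypothesis win_windowed : forall k, windowed k (win k).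
Hypothesis win_head : forall k, exists l, win k = (k%:R * D, x0) :: l.

Definition first_windows (k : nat) := flatten [seq win j | j <- iota 0 k].

Notation start k := (size (first_windows k)).

(* Every window is nonempty, so the first [i.+1] of them contain at least
   [i.+1] items. *)
Definition item (i : nat) : R * T := nth (0, x0) (first_windows i.+1) i.

Lemma first_windowsS k : first_windows k.+1 = first_windows k ++ win k.
Proof.
by rewrite /first_windows -addn1 iotaD map_cat flatten_cat /= cats0 add0n.
Qed.

Lemma win_size k : (0 < size (win k))%N.
Proof. by have [l ->] := win_head k. Qed.

Lemma leq_start k : (k <= start k)%N.
Proof.
elim: k => // k IH; rewrite first_windowsS size_cat.
by have := win_size k; lia.
Qed.

Lemma first_windows_prefix j k :
  (j <= k)%N -> exists l, first_windows k = first_windows j ++ l.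
Proof.
move=> /subnKC <-; elim: (k - j)%N => [|r [l IH]].
  by exists [::]; rewrite addn0 cats0.
by exists (l ++ win (j + r)); rewrite addnS first_windowsS IH catA.
Qed.

Lemma nth_first_windows k i :
  (i < start k)%N -> nth (0, x0) (first_windows k) i = item i.
Proof.
move=> ik; rewrite /item; have si := leq_start i.+1.
case/orP: (leq_total k i.+1) => /first_windows_prefix[l ->].
  by rewrite nth_cat ik.
by rewrite nth_cat si.
Qed.

Lemma mkseq_item k : mkseq item (start k) = first_windows k.
Proof.
apply: (@eq_from_nth _ (0, x0)); rewrite size_mkseq // => i ik.
by rewrite nth_mkseq // nth_first_windows.
Qed.

Lemma item_win k r :
  (r < size (win k))%N -> item (start k + r) = nth (0, x0) (win k) r.
Proof.
move=> rk; rewrite -(@nth_first_windows k.+1) first_windowsS.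
  by rewrite nth_cat ltnNge leq_addr /= addKn.
by rewrite size_cat ltn_add2l.
Qed.

Lemma item_start k : item (start k) = (k%:R * D, x0).
Proof.
rewrite -[X in item X]addn0 item_win ?win_size //.
by have [l ->] := win_head k.
Qed.

Lemma mkseq_item_take k r : (r <= size (win k))%N ->
  mkseq item (start k + r) = first_windows k ++ take r (win k).
Proof.
move=> rk; apply: (@eq_from_nth _ (0, x0)).
  by rewrite size_mkseq size_cat size_takel.
move=> i; rewrite size_mkseq => ik.
rewrite nth_mkseq // -(@nth_first_windows k.+1); last first.
  by rewrite first_windowsS size_cat; lia.
rewrite first_windowsS !nth_cat; case: ltnP => // ki.
by rewrite nth_take // ltn_subLR.
Qed.

Lemma find_window i : exists k r, i = (start k + r)%N /\ (r < size (win k))%N.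
Proof.
elim: i => [|i [k [r [-> rk]]]]; first by exists 0%N, 0%N; rewrite win_size.
case: (ltnP r.+1 (size (win k))) => rk'; first by exists k, r.+1; rewrite addnS.
exists k.+1, 0%N; rewrite win_size first_windowsS size_cat; split => //; lia.
Qed.

Lemma first_windows_lt k :
  all (fun x => x.1 < k%:R * D) (first_windows k).
Proof.
elim: k => // k IH; rewrite first_windowsS all_cat; apply/andP; split.
  apply: sub_all IH => x /= /lt_le_trans; apply.
  by rewrite ler_pM2r // ler_nat.
by have /andP[_] := win_windowed k; apply: sub_all => x /andP[].
Qed.

Lemma first_windows_sorted k : sorted tle (first_windows k).
Proof.
elim: k => // k IH; rewrite first_windowsS sorted_tle_cat IH.
have /andP[-> wk] /= := win_windowed k.
apply: sub_all (first_windows_lt k) => x /= xk.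
by apply: sub_all wk => y /= /andP[ky _]; exact: (le_trans (ltW xk)).
Qed.

Lemma item_le i j : (i <= j)%N -> (item i).1 <= (item j).1.
Proof.
move=> ij; have js := leq_start j.+1.
rewrite -!(@nth_first_windows j.+1) ?(leq_trans _ js) //.
have tle_refl : reflexive (@tle R T) by move=> x; exact: lexx.
apply: (sorted_leq_nth (@tle_trans R T) tle_refl (0, x0)) (ij).
- exact: first_windows_sorted.
- by rewrite inE (leq_ltn_trans ij js).
- by rewrite inE.
Qed.

Lemma item_ge0 i : 0 <= (item i).1.
Proof. by have := item_le (leq0n i); rewrite (item_start 0) /= mul0r. Qed.

Lemma item_diverges B : exists i, B < (item i).1.
Proof.
pose k := Num.bound `|B / D|; exists (start k); rewrite item_start /=.
rewrite -ltr_pdivrMr //; apply: le_lt_trans (ler_norm _) _.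
exact: archi_boundP.
Qed.

Lemma item_lt_start i k : (item i).1 < k%:R * D -> (i < start k)%N.
Proof.
move=> ik; rewrite ltnNge; apply/negP => /item_le.
by rewrite item_start leNgt ik.
Qed.

Definition item_log X (g : T -> seq X) (i : nat) : seq X :=
  [seq y.2 | y <- items g (mkseq item i)].

Lemma item_log_start X (g : T -> seq X) k :
  item_log g (start k) =
  flatten [seq [seq y.2 | y <- items g (win j)] | j <- iota 0 k].
Proof.
rewrite /item_log mkseq_item; elim: k => // k IH.
rewrite first_windowsS items_cat map_cat IH.
by rewrite -[in RHS]addn1 iotaD map_cat flatten_cat /= cats0.
Qed.

Lemma item_logS X (g : T -> seq X) i :
  item_log g i.+1 = item_log g i ++ g (item i).2.
Proof.
rewrite /item_log mkseqS -cats1 items_cat map_cat /items /= cats0 -map_comp.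
by rewrite (@eq_map _ _ _ id) ?map_id.
Qed.

Lemma item_log_take X (g : T -> seq X) k r : (r <= size (win k))%N ->
  item_log g (start k + r) =
  item_log g (start k) ++ [seq y.2 | y <- items g (take r (win k))].
Proof.
by move=> rk; rewrite /item_log mkseq_item_take // items_cat map_cat mkseq_item.
Qed.

Lemma item_log_prefix X (g : T -> seq X) i j :
  (i <= j)%N -> exists r, item_log g j = item_log g i ++ r.
Proof.
move=> /subnKC <-; elim: (j - i)%N => [|n [r IH]].
  by exists [::]; rewrite addn0 cats0.
by rewrite addnS item_logS IH -catA; eexists.
Qed.

(** Window [k.+1] receives exactly what window [k] sends, [D] later. Cutting the logs at window
    boundaries gives the order and causality of the link, and comparing times inside two consecutive
    windows gives the delay. *)
Lemma item_links X (snd rcv : T -> seq X) :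
  items rcv (win 0) = [::] ->
  (forall k, items rcv (win k.+1) =
             [seq (x.1 + D, x.2) | x <- items snd (win k)]) ->
  forall i,
    (exists r, item_log snd i = item_log rcv i.+1 ++ r) /\
    (exists2 j, (item j).1 <= (item i).1 + D
              & (size (item_log snd i.+1) <= size (item_log rcv j.+1))%N).
Proof.
move=> rcv0 rcvS i.
have log_eq k : item_log rcv (start k.+1) = item_log snd (start k).
  rewrite !item_log_start /= rcv0 /= -[1%N]add1n iotaDl -map_comp.
  congr flatten; apply: eq_map => j /=; rewrite add1n rcvS -map_comp.
  exact: eq_map.
have [k [r [-> rk]]] := find_window i; split.
  have [|l hl] := @item_log_prefix _ rcv (start k + r).+1 (start k.+1).
    by rewrite first_windowsS size_cat; lia.
  have [|l' ->] := @item_log_prefix _ snd (start k) (start k + r).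
    by rewrite leq_addr.
  by rewrite -log_eq hl -catA; eexists.
set t := (item _).1.
have /andP[sk wk] := win_windowed k.
have /andP[sk1 wk1] := win_windowed k.+1.
have t_win : in_window k t.
  by rewrite /t item_win //; exact/(all_nthP (0, x0) wk).
(* The reception deadline is [t + D], and the last item that meets it has offset [c.-1] in window
   [k.+1]. The head of that window, at [k.+1%:R * D], meets it, so [c] is positive. *)
pose c := count (fun x : R * T => x.1 <= t + D) (win k.+1).
have c_gt0 : (0 < c)%N.
  rewrite /c; have [l ->] := win_head k.+1.
  rewrite /= (_ : _ <= _); first by rewrite add1n.
  move: t_win => /andP[+ _]; rewrite -natr1 mulrDl mul1r; lra.
have c_le : (c <= size (win k.+1))%N by exact: count_size.
exists (start k.+1 + c.-1)%N.
  rewrite item_win ?prednK //; have := take_count_le (t + D) sk1.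
  rewrite -/c => ec.
  have : all (fun x : R * T => x.1 <= t + D) (take c (win k.+1)).
    by rewrite ec filter_all.
  move=> /(all_nthP (0, x0))/(_ c.-1).
  by rewrite size_takel // nth_take prednK // leqnn; apply.
rewrite -!addnS prednK // !item_log_take // log_eq !size_cat leq_add2l !size_map.
rewrite /c take_count_le // -(@filter_items _ _ _ _ (fun u => u <= t + D)) rcvS.
rewrite filter_map size_map.
rewrite (@eq_filter _ _ (fun x => x.1 <= t)); last first.
  by move=> x; rewrite /= lerD2r.
rewrite (@filter_items _ _ _ _ (fun u => u <= t)).
(* By sortedness, the items of window [k] up to offset [r] all have time at most [t], so whatever
   they send is among the receptions counted. *)
rewrite -{2}(cat_take_drop r.+1 (win k)) filter_cat items_cat size_cat.
suff -> : [seq x <- take r.+1 (win k) | x.1 <= t] = take r.+1 (win k).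
  exact: leq_addr.
apply/all_filterP/(all_nthP (0, x0)) => j; rewrite size_takel // => jr.
rewrite nth_take // -item_win; last exact: leq_trans rk.
by apply: item_le; rewrite leq_add2l.
Qed.

End Windows.
(** * Traces of histories *)

Section Histories.
Variables (R : realType) (P : finType) (Pi Theta : {set P}) (M : eqType).
Variables (A : algorithm R Theta M) (D : R).
Hypothesis D_gt0 : 0 < D.

Notation act := (action A).
Notation msg := (link_msg A).
Notation inp := (input P msg M).
Notation lstate := (local_state A).

Definition sent_to (q : P) (a : act) : seq msg :=
  [seq u.2 | u <- sends (act_out a) & u.1 == q].

Definition received_from (p : P) (x : inp) : seq msg :=
  if x is Recv p' w then if p' == p then [:: w] else [::] else [::].

Definition broadcast_in (x : inp) : seq M := if x is Bcast m then [:: m] else [::].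

Definition next_state (p : P) (s : lstate) (e : R * act) : lstate :=
  (alg_step p s e.1 (act_in e.2)).1.

Definition may_take (p : P) (s : lstate) (t : R) (x : inp) : Prop :=
  match x with
  | Recv _ _ => True
  | Bcast _ => p \in Theta
  | Wake => exists2 d, alarm p s = Some d & d <= t
  end.

(* [l] lists the steps that a correct [p], in state [s] at time [now], takes
   before time [b], with no alarm missed. *)
Fixpoint local_run (p : P) (b now : R) (s : lstate) (l : seq (R * act)) : Prop :=
  if l is e :: l' then
    [/\ now <= e.1 < b, forall d, alarm p s = Some d -> e.1 <= Num.max now d,
        may_take p s e.1 (act_in e.2),
        e.2 = Action p (act_in e.2) (alg_step p s e.1 (act_in e.2)).2
      & local_run p b e.1 (next_state p s e) l']
  else forall d, alarm p s = Some d -> b <= d.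

Lemma local_run_alarm p b now s l : local_run p b now s l ->
  forall d, alarm p (foldl (next_state p) s l) = Some d -> b <= d.
Proof. by elim: l now s => //= e l IH now s [_ _ _ _ /IH]. Qed.

Definition trace_state (p : P) (s : lstate) (e : R * option act) : lstate :=
  if e.2 is Some a then
    if actor a == p then next_state p s (e.1, a) else s
  else s.

(** The analogue of [local_run] for lists that also contain idle events and events of other
    processes: none of these may go past an alarm of [p] either. The maximum with [now] makes an
    alarm set in the past due at once. *)
Fixpoint obeys (p : P) (now : R) (s : lstate) (l : seq (R * option act)) : Prop :=
  if l is e :: l' then
    [/\ forall d, alarm p s = Some d -> e.1 <= Num.max now d,
        forall a, e.2 = Some a -> actor a = p ->
          may_take p s e.1 (act_in a) /\
          act_out a = (alg_step p s e.1 (act_in a)).2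
      & obeys p e.1 (trace_state p s e) l']
  else True.

Lemma obeys_cat p now s l l' : obeys p now s l ->
  (forall now', obeys p now' (foldl (trace_state p) s l) l') ->
  obeys p now s (l ++ l').
Proof. by elim: l now s => //= e l IH now s [? ? /IH]; split; auto. Qed.

Lemma obeys_nth p now s l x0 i : obeys p now s l -> (i < size l)%N ->
  let e := nth x0 l i in
  let s' := foldl (trace_state p) s (take i l) in
  (forall d, alarm p s' = Some d ->
     e.1 <= Num.max (if i is i'.+1 then (nth x0 l i').1 else now) d) /\
  (forall a, e.2 = Some a -> actor a = p ->
     may_take p s' e.1 (act_in a) /\ act_out a = (alg_step p s' e.1 (act_in a)).2).
Proof.
elim: l now s i => // e l IH now s [|i] /=; first by case.
by case=> _ _ /IH {}IH; rewrite ltnS => /IH; case: i.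
Qed.

Definition traced (l : seq (R * act)) : seq (R * option act) :=
  [seq (x.1, Some x.2) | x <- l].

Lemma foldl_traced p s l :
  foldl (trace_state p) s (traced l) =
  foldl (next_state p) s [seq x <- l | actor x.2 == p].
Proof.
elim: l s => //= -[t a] l IH s; rewrite IH /trace_state /=.
by case: (actor a == p).
Qed.

(** An event of another process comes before the next step of [p], or before [b] if there is none,
    and neither of these goes past the alarm of [p]. Two times are needed for the induction: [now]
    is that of the last step of [p], whereas [now'] also advances with the other events. *)
Lemma obeys_traced p b now now' s l : now <= now' -> sorted tle l ->
  all (fun x => now' <= x.1 < b) l ->
  local_run p b now s [seq x <- l | actor x.2 == p] ->
  obeys p now' s (traced l).
Proof.
elim: l now now' s => // -[t a] l IH now now' s nn.
rewrite sorted_tle_cons => /andP[tl sl] /= /andP[/andP[n't tb] al].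
have al' : all (fun x => t <= x.1 < b) l.
  move: tl al; elim: l {IH sl} => //= x l IH /andP[-> /IH {}IH].
  by case/andP=> /andP[_ ->] /IH ->.
case: (eqVneq (actor a) p) => [ap|ap].
  move=> [/andP[nt _] /= C mt ea lr]; split.
  - by move=> d /C; rewrite !le_max => /orP[/le_trans->|->] //; rewrite orbT.
  - by move=> _ [<-] _; split=> //; rewrite {1}ea.
  - by rewrite /trace_state /= ap eqxx; exact: IH lr.
move=> lr; split => [d ad|_ [<-] /eqP|].
- rewrite le_max; case E: [seq x <- l | actor x.2 == p] lr => [|x l'] /=.
    by move=> /(_ _ ad) /(lt_le_trans tb)/ltW ->; rewrite orbT.
  case=> _ /(_ _ ad) + _ _ _; rewrite le_max.
  have tx : t <= x.1.
    have : all (fun y => t <= y.1) [seq x <- l | actor x.2 == p].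
      by rewrite all_filter; apply: sub_all tl => y /= ->; rewrite implybT.
    by rewrite E => /andP[].
  case/orP => /(le_trans tx) H; rewrite ?H ?orbT //.
  by rewrite (le_trans H nn).
- by rewrite (negPf ap).
- by rewrite /trace_state /= (negPf ap); apply: IH lr => //; exact: le_trans n't.
Qed.

(** * Merging the histories of all processes into one trace *)

Section HistoryTrace.
Variables (h : nat -> P -> seq (R * act)) (F : {set P}) (ini : P -> lstate).
Hypothesis h_windowed : forall k p, windowed D k (h k p).
Hypothesis h_actor : forall k p, all (fun x => actor x.2 == p) (h k p).

Definition merged (k : nat) : seq (R * act) :=
  sort tle (flatten [seq h k p | p <- enum P]).

(* The idle event makes every window nonempty. *)
Definition window (k : nat) : seq (R * option act) :=
  (k%:R * D, None) :: traced (merged k).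

Lemma merged_actor k p : [seq x <- merged k | actor x.2 == p] = h k p.
Proof.
rewrite (filter_sort (@tle_total _ _) (@tle_trans _ _)).
rewrite (filter_flatten_pick (i := p)) => [|q qp].
  rewrite (all_filterP (h_actor k p)) (sorted_sort (@tle_trans _ _)) //.
  by case/andP: (h_windowed k p).
apply/nilP; rewrite /nilp size_filter -leqn0 leqNgt -has_count -all_predC.
by apply: sub_all (h_actor k q) => x /eqP /= ->.
Qed.

Lemma merged_windowed k : windowed D k (merged k).
Proof.
rewrite /windowed (sort_sorted (@tle_total _ _)) all_sort /=.
elim: (enum P) => //= p s; rewrite all_cat => ->.
by case/andP: (h_windowed k p) => _ ->.
Qed.

Lemma window_windowed k : windowed D k (window k).
Proof.
have /andP[sm am] := merged_windowed k.
rewrite /windowed sorted_tle_cons /= /in_window lexx /= ltr_pM2r // ltr_nat.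
rewrite ltnSn /traced sorted_map !all_map sm am !andbT /=.
by apply: sub_all am => x /andP[].
Qed.

Lemma window_head k : exists l, window k = (k%:R * D, None) :: l.
Proof. by eexists. Qed.

Notation event_at := (item None window).
Notation start k := (size (first_windows window k)).

(** Clocks show real time. States are obtained by replaying the inputs through the algorithm; for
    members of [F] they carry no meaning. *)
Definition hist_trace : trace A :=
  Trace (fun i => (event_at i).1) (fun i => (event_at i).2) F (fun _ t => t)
        (fun i p => foldl (trace_state p) (ini p) (mkseq event_at i)).

Definition of_event X (g : act -> seq X) (o : option act) : seq X :=
  if o is Some a then g a else [::].

Lemma log_item_log X (g : act -> seq X) i :
  log hist_trace g i = item_log None window (of_event g) i.
Proof. by rewrite /log /item_log map_snd_items /mkseq -map_comp. Qed.

Lemma items_window X (g : act -> seq X) k p :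
  (forall a, actor a != p -> g a = [::]) ->
  items (of_event g) (window k) = items g (h k p).
Proof.
move=> gp; rewrite items_cons /= /traced items_map -(merged_actor k p).
by rewrite items_filter // => x /gp.
Qed.

Lemma log_start X (g : act -> seq X) k p :
  (forall a, actor a != p -> g a = [::]) ->
  log hist_trace g (start k) =
  flatten [seq [seq y.2 | y <- items g (h j p)] | j <- iota 0 k].
Proof.
move=> gp; rewrite log_item_log (item_log_start D_gt0 window_head).
by congr flatten; apply: eq_map => j; rewrite (items_window _ gp).
Qed.

Lemma items_only X (g : act -> seq X) k p :
  items (fun a => if actor a == p then g a else [::]) (h k p) = items g (h k p).
Proof.
elim: (h k p) (h_actor k p) => //= x l IH /andP[/eqP xp /IH].
by rewrite !items_cons xp eqxx => ->.
Qed.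

(** At window boundaries the deliveries of [s] depend on the history of [s] alone, which allows
    moving them from one trace to another. *)
Lemma delivered_start s k :
  delivered hist_trace s (start k) =
  flatten [seq [seq y.2 | y <- items (fun a => dlvs (act_out a)) (h j s)]
          | j <- iota 0 k].
Proof.
rewrite /delivered (@log_start _ _ _ s) => [|a /negPf-> //].
by congr flatten; apply: eq_map => j; rewrite items_only.
Qed.

Lemma delivered_le_start s i k x : (i <= start k)%N ->
  x \in delivered hist_trace s i -> x \in delivered hist_trace s (start k).
Proof.
move=> ik; have [r] := item_log_prefix None window
  (of_event (fun a => if actor a == s then dlvs (act_out a) else [::])) ik.
rewrite -!log_item_log -/(delivered _ _ _) /delivered => ->.
by rewrite mem_cat => ->.
Qed.

Lemma log_prefix X (g : act -> seq X) i j :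
  (i <= j)%N -> exists r, log hist_trace g j = log hist_trace g i ++ r.
Proof.
by move=> /(item_log_prefix None window (of_event g)); rewrite !log_item_log.
Qed.

Lemma hist_links :
  (forall p q, items (received_from p \o @act_in _ _ _ _ A) (h 0%N q) = [::]) ->
  (forall p q k, items (received_from p \o @act_in _ _ _ _ A) (h k.+1 q) =
     [seq (x.1 + D, x.2) | x <- items (sent_to q) (h k p)]) ->
  links_within hist_trace D.
Proof.
move=> rcv0 rcvS p q i.
pose snd (a : act) := if actor a == p then sent_to q a else [::].
pose rcv (a : act) := if actor a == q then received_from p (act_in a) else [::].
have Esnd k : items (of_event snd) (window k) = items (sent_to q) (h k p).
  by rewrite (@items_window _ _ _ p) => [|a /negPf ap]; rewrite /snd ?items_only ?ap.
have Ercv k : items (of_event rcv) (window k) =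
    items (received_from p \o @act_in _ _ _ _ A) (h k q).
  by rewrite (@items_window _ _ _ q) => [|a /negPf aq]; rewrite /rcv ?items_only ?aq.
have := item_links D_gt0 window_windowed window_head (snd := of_event snd)
  (rcv := of_event rcv).
rewrite Ercv => /(_ (rcv0 p q)).
have ES k : items (of_event rcv) (window k.+1) =
    [seq (x.1 + D, x.2) | x <- items (of_event snd) (window k)].
  by rewrite Ercv Esnd rcvS.
move=> /(_ ES i)[[r Er] [j tj lj]]; split; [exists r|exists j => //];
by rewrite /sent /received !log_item_log.
Qed.

Lemma hist_time_diverges : time_diverges hist_trace.
Proof.
split=> [|i|B].
- exact: (item_ge0 D_gt0 window_windowed window_head 0).
- exact: (item_le D_gt0 window_windowed window_head (leqnSn i)).
- exact: (item_diverges D_gt0 window_head B).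
Qed.

Lemma hist_clocks : clocks_within hist_trace 0.
Proof. by move=> p t; rewrite /= subrr normr0. Qed.

Notation hist_state p k :=
  (foldl (next_state p) (ini p) (first_windows (h ^~ p) k)).

Definition runs_locally (p : P) : Prop :=
  forall k, local_run p (k.+1%:R * D) (k%:R * D) (hist_state p k) (h k p).

Lemma trace_state_start p k :
  foldl (trace_state p) (ini p) (first_windows window k) = hist_state p k.
Proof.
elim: k => // k IH; rewrite !first_windowsS !foldl_cat IH.
by rewrite -[in RHS](merged_actor k p) -foldl_traced.
Qed.

Lemma obeys_window p k now : runs_locally p -> (0 < k)%N || (0 <= now) ->
  obeys p now (hist_state p k) (window k).
Proof.
move=> lr now0; have /andP[sm am] := merged_windowed k; split=> //=; last first.
  by apply: (obeys_traced (lexx _) sm am); rewrite merged_actor; exact: lr.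
(* The idle event that opens the window must not go past an alarm. In window 0 it occurs at time 0,
   which is at most [now]; later, the previous [local_run] leaves no alarm due before its end. *)
move=> d ad; rewrite le_max; case: k now0 ad {sm am} => [|k] /=.
  by rewrite mul0r => ->.
rewrite first_windowsS foldl_cat => _ /(local_run_alarm (lr k)) ->.
by rewrite orbT.
Qed.

Lemma obeys_first_windows p k : runs_locally p ->
  obeys p 0 (ini p) (first_windows window k).
Proof.
move=> lr; elim: k => // -[_|k IH].
  by rewrite first_windowsS; apply: (@obeys_window p 0 0); rewrite // lexx orbT.
rewrite first_windowsS; apply: obeys_cat => // now.
by rewrite trace_state_start; exact: obeys_window.
Qed.

Lemma obeys_trace p i : runs_locally p ->
  let e := event_at i in
  let s := state hist_trace i p in
  (forall d, alarm p s = Some d ->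
     e.1 <= Num.max (if i is i'.+1 then (event_at i').1 else 0) d) /\
  (forall a, e.2 = Some a -> actor a = p ->
     may_take p s e.1 (act_in a) /\ act_out a = (alg_step p s e.1 (act_in a)).2).
Proof.
move=> /(@obeys_first_windows _ i.+1) ob.
have si : (i < start i.+1)%N by exact: (leq_start D_gt0 window_head i.+1).
have := obeys_nth (0, None) ob si.
have nthE j : (j <= i)%N ->
    nth (0, None) (first_windows window i.+1) j = event_at j.
  move=> ji; apply: (nth_first_windows D_gt0 window_head); exact: leq_trans si.
have -> : take i (first_windows window i.+1) = mkseq event_at i.
  apply: (@eq_from_nth _ (0, None)); rewrite size_takel ?(ltnW si) //.
    by rewrite size_mkseq.
  by move=> j ji; rewrite nth_take // nth_mkseq // nthE // ltnW.
by rewrite nthE //=; case: i {ob si} nthE => // i nthE; rewrite nthE.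
Qed.

Lemma hist_follows p : runs_locally p -> alg_init p (ini p) ->
  follows_algorithm hist_trace p.
Proof.
move=> lr ip; split=> // i.
have stS : state hist_trace i.+1 p =
    trace_state p (state hist_trace i p) (event_at i).
  rewrite [LHS](_ : _ = foldl (trace_state p) (ini p) (mkseq event_at i.+1)) //.
  by rewrite mkseqS -cats1 foldl_cat.
split=> [x y ev|nt].
  have [_ /(_ _ ev erefl) [mt yE]] := obeys_trace i lr.
  split; first by case: x ev mt yE.
  rewrite stS /trace_state [(event_at i).2]ev /= eqxx /next_state /= [y]yE.
  by case: alg_step.
rewrite stS /trace_state; case ev : (event_at i).2 => [[q x y]|] //=.
by case: eqP => // qp; case: (nt x); exists y; rewrite /= ev qp.
Qed.

(* [obeys_trace] says that time never jumps past a pending alarm; an alarm which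
   is never replaced would thus bound all times. *)
Lemma hist_steps lag : 0 <= lag -> (forall p, p \notin F -> runs_locally p) ->
  steps_within hist_trace lag.
Proof.
move=> lag0 lr p i d t pF ai ti dt; apply: NNPP => no.
have stay j : (i <= j)%N -> alarm p (state hist_trace j p) = Some d /\
    (if j is j'.+1 then time hist_trace j' else 0) <= t.
  move=> /subnKC <-; elim: (j - i)%N => [|n [an tn]]; first by rewrite addn0.
  have tin : time hist_trace (i + n) <= t.
    have [/(_ _ an) C _] := obeys_trace (i + n) (lr p pF).
    by apply: le_trans C _; rewrite ge_max tn.
  rewrite addnS; split=> //; apply: NNPP => ch; apply: no.
  exists (i + n)%N; split; [exact: leq_addr| |by right].
  by rewrite (le_trans tin) // lerDl.
have [j tj] := item_diverges D_gt0 window_head t.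
have [|_] := stay (maxn i j).+1; first by rewrite leqW // leq_maxl.
apply/negP; rewrite -ltNge; apply: lt_le_trans tj _.
exact: (item_le D_gt0 window_windowed window_head (leq_maxr i j)).
Qed.

(** * Broadcasts in the trace of a history *)

Notation broadcasts_of := (items (broadcast_in \o @act_in _ _ _ _ A)).
Notation broadcast_by p :=
  (fun a : act => if actor a == p then broadcast_in (act_in a) else [::]).

Lemma log_broadcasts p k :
  log hist_trace (broadcast_by p) (start k) =
  flatten [seq [seq y.2 | y <- broadcasts_of (h j p)] | j <- iota 0 k].
Proof.
rewrite (@log_start _ _ _ p) => [|a /negPf-> //].
by congr flatten; apply: eq_map => j; rewrite items_only.
Qed.

Lemma log_takes_broadcast p i m : takes hist_trace i p (Bcast m) ->
  log hist_trace (broadcast_by p) i.+1 =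
  log hist_trace (broadcast_by p) i ++ [:: m].
Proof.
by case=> y ev; rewrite !log_item_log item_logS [(event_at i).2]ev /= eqxx.
Qed.

Lemma no_broadcast p : (forall k, broadcasts_of (h k p) = [::]) ->
  forall i m, ~ takes hist_trace i p (Bcast m).
Proof.
move=> nb i m /log_takes_broadcast E.
have [r] := log_prefix (broadcast_by p) (leq_start D_gt0 window_head i.+1).
rewrite log_broadcasts E.
suff -> : flatten [seq [seq y.2 | y <- broadcasts_of (h j p)]
                  | j <- iota 0 i.+1] = [::].
  by move=> /(congr1 size); rewrite !size_cat /=; lia.
by elim: (iota _ _) => //= j s ->; rewrite nb.
Qed.

(** The broadcast log of [p] has at most one entry, while two distinct indices would contribute one
    entry each. *)
Lemma one_broadcast p :
  (forall k, (size (broadcasts_of (h k p)) <= (k == 0))%N) ->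
  forall i j m m', takes hist_trace i p (Bcast m) ->
  takes hist_trace j p (Bcast m') -> i = j.
Proof.
move=> nb.
have bound i : (size (log hist_trace (broadcast_by p) i.+1) <= 1)%N.
  have [r] := log_prefix (broadcast_by p) (leq_start D_gt0 window_head i.+1).
  rewrite log_broadcasts => /(congr1 size); rewrite size_cat => E.
  apply: leq_trans (leq_addr (size r) _) _; rewrite -E /= size_cat size_map.
  have := nb 0%N; suff -> : flatten [seq [seq y.2 | y <- broadcasts_of (h j p)]
                        | j <- iota 1 i] = [::] by rewrite addn0.
  have : all (leq 1) (iota 1 i) by apply/allP => j; rewrite mem_iota => /andP[].
  elim: (iota _ _) => //= j s IH /andP[j1 /IH ->].
  by have := nb j; case: j j1 => //= j _; rewrite leqn0 => /nilP ->.
have lt i j m m' : takes hist_trace i p (Bcast m) ->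
    takes hist_trace j p (Bcast m') -> ~ (i < j)%N.
  move=> /log_takes_broadcast Ei /log_takes_broadcast Ej ij; have := bound j.
  have [r] := log_prefix (broadcast_by p) ij; rewrite Ei Ej => ->.
  by rewrite !size_cat /=; lia.
move=> i j m m' ti tj; case: (ltngtP i j) => // ij.
- by case: (lt _ _ _ _ ti tj).
- by case: (lt _ _ _ _ tj ti).
Qed.

Lemma broadcast_time p m t : (t, m) \in broadcasts_of (h 0%N p) ->
  exists2 i, time hist_trace i = t & takes hist_trace i p (Bcast m).
Proof.
rewrite -items_only -(items_window 0 (p := p)) => [|a /negPf-> //].
rewrite (_ : window 0 = mkseq event_at (start 1)); last first.
  by rewrite (mkseq_item D_gt0 window_head) /first_windows /= cats0.
elim: (start 1) => // n IH; rewrite mkseqS -cats1 items_cat mem_cat.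
case/orP=> [/IH //|]; rewrite /items /= cats0 => /mapP[m' H [-> ->]].
exists n => //; rewrite /takes [event _ _](_ : _ = (event_at n).2) //.
move: H; case: (event_at n).2 => [[q x y]|] //=; case: eqP => // ->.
by case: x => // m''; rewrite inE => /eqP ->; exists y.
Qed.

Lemma hist_base f : (#|F :&: Pi| <= f)%N ->
  (forall p, p \notin F -> [/\ alg_init p (ini p), runs_locally p &
     forall k, (size (broadcasts_of (h k p)) <= (k == 0))%N]) ->
  base_execution Pi hist_trace f.
Proof.
move=> Ff cp; split=> //; last exact: hist_time_diverges.
- by move=> p /cp[ip lr _]; exact: hist_follows.
- by move=> theta m i j /cp[_ _ /one_broadcast ob] bi bj; exact: ob bi bj.
Qed.

End HistoryTrace.
(** * Runs with all delays equal to [D] *)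

Definition is_wake (x : inp) : bool := if x is Wake then true else false.

Definition accepted (p : P) (x : inp) : bool :=
  match x with Recv _ _ => true | Bcast _ => p \in Theta | Wake => false end.

(** Wake-ups are dictated by the alarms of the algorithm; the remaining inputs are those that a
    construction can prescribe. *)
Definition external (l : seq (R * act)) : seq (R * inp) :=
  [seq x <- [seq (e.1, act_in e.2) | e <- l] | ~~ is_wake x.2].

Lemma items_external X (g : inp -> seq X) l :
  g Wake = [::] -> items (g \o @act_in _ _ _ _ A) l = items g (external l).
Proof.
move=> gW; rewrite items_filter => [|[t [q w|m|]] //].
by rewrite -items_map.
Qed.

Lemma local_run_windowed p b now s l : local_run p b now s l ->
  [/\ sorted tle l, all (fun x => now <= x.1 < b) l
    & all (fun x => actor x.2 == p) l].
Proof.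
elim: l now s => // -[t a] l IH now s [/andP[nt tb] _ _ aE /IH[sl wl al]].
have ap : actor a = p by rewrite [a]aE.
rewrite sorted_tle_cons sl andbT /= ap eqxx nt tb al; split=> //.
  by apply: sub_all wl => x /andP[].
by apply: sub_all wl => x /andP[/(le_trans nt) -> ->].
Qed.

(** Alarms are handled one after another until none is due before [b]; an endless chain of them is
    excluded by [alg_nonzeno]. If [now' = b], an alarm may be left due at [b] behind an input
    arriving then; the strict clause rules this out at the end of a window. *)
Lemma wake_until p b now s : now <= b -> exists l s' now',
  [/\ now' <= b /\ (now < b -> now' < b), external l = [::],
      forall d, alarm p s' = Some d -> b <= Num.max now' d
    & forall c l', b <= c -> local_run p c now' s' l' ->
      local_run p c now s (l ++ l')].
Proof.
pose good n s := exists l s' now',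
  [/\ now' <= b /\ (n < b -> now' < b), external l = [::],
      forall d, alarm p s' = Some d -> b <= Num.max now' d
    & forall c l', b <= c -> local_run p c now' s' l' ->
      local_run p c n s (l ++ l')].
move=> nb; apply: NNPP => bad.
(* The default 0 is never reached: as long as [good] fails, an alarm is set. *)
pose wake (u : lstate * R) :=
  let t := Num.max u.2 (odflt 0 (alarm p u.1)) in ((alg_step p u.1 t Wake).1, t).
pose u k := iter k wake (s, now).
have step k : (u k).2 <= b -> ~ good (u k).2 (u k).1 ->
    exists2 d, alarm p (u k).1 = Some d & Num.max (u k).2 d < b.
  move=> ub nu; apply: NNPP => nd; apply: nu; exists [::], (u k).1, (u k).2.
  split=> // d ad; rewrite leNgt; apply/negP => db; apply: nd; by exists d.
(* Failure propagates along the chain, since prepending one wake-up to a solution for [k.+1] would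
   give a solution for [k]. *)
have inv k : (u k).2 <= b /\ ~ good (u k).2 (u k).1.
  elim: k => [|k [ub nu]]; first by split.
  have [d ad tb] := step k ub nu.
  rewrite /u iterS -/(u k) /wake ad /=; split=> [|[l [s' [n [[nb' nb''] el al lr]]]]].
    exact: ltW.
  apply: nu; exists ((Num.max (u k).2 d,
    Action p Wake (alg_step p (u k).1 (Num.max (u k).2 d) Wake).2) :: l), s', n.
  split=> //; first by split=> // _; exact: nb''.
  move=> c l' bc /(lr c l' bc) {}lr; split=> //=.
  - by rewrite le_max lexx (lt_le_trans tb).
  - by move=> d'; rewrite ad => -[<-].
  - by exists d; rewrite // le_max lexx orbT.
have alarms k : exists2 d, alarm p (u k).1 = Some d & Num.max (u k).2 d < b.
  by have [ub nu] := inv k; exact: step.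
(* The times are shifted by one: [u k] pairs a state with the time of the step that led to it,
   whereas [alg_nonzeno] pairs it with the time of the step taken from it. *)
have [k|k] := alg_nonzeno (p := p) (s := fun k => (u k).1)
  (c := fun k => (u k.+1).2) _ b.
  split; first by rewrite /u iterS.
  have [d ad _] := alarms k.+1; exists d => //.
  by rewrite {1}/u iterS /wake /= -/(u k.+1) ad.
by apply/negP; rewrite -leNgt; exact: (inv k.+1).1.
Qed.

Lemma external_cat l l' : external (l ++ l') = external l ++ external l'.
Proof. by rewrite /external map_cat filter_cat. Qed.

(** Wake-ups fill the gap before each prescribed arrival, and the gap from the last arrival to
    [b]. *)
Lemma local_run_exists p b now s arr : now < b ->
  path <=%R now [seq x.1 | x <- arr] ->
  all (fun x => (x.1 < b) && accepted p x.2) arr ->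
  exists l, local_run p b now s l /\ external l = arr.
Proof.
elim: arr now s => [|[t x] arr IH] now s nb /=.
  move=> _ _; have [l [s' [n [[_ /(_ nb) n'b] el al lr]]]] := wake_until p s (ltW nb).
  exists l; split=> //; rewrite -(cats0 l); apply: lr => // d /al.
  by rewrite le_max leNgt n'b.
move=> /andP[nt sarr] /andP[/andP[tb acc] accs].
have [l [s' [n [[n't _] el al lr]]]] := wake_until p s nt.
pose r := alg_step p s' t x.
have [l' [lr' el']] := IH t r.1 tb sarr accs.
exists (l ++ (t, Action p x r.2) :: l'); split.
  apply: (lr b _ (ltW tb)); split=> //=; first by rewrite n't.
  by case: x acc {r lr' el'}.
rewrite external_cat el /= /external /= -/(external l') el'.
by case: x acc {r lr' el'}.
Qed.

(* Being a function of the inputs, this makes indistinguishable processes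
   behave identically. *)
Definition run_on (p : P) (b now : R) (s : lstate) (arr : seq (R * inp)) :=
  epsilon (inhabits [::]) (fun l => local_run p b now s l /\ external l = arr).

Definition arrivals (q : P) (src : P -> seq (R * act)) : seq (R * inp) :=
  sort tle (flatten
    [seq [seq (x.1 + D, Recv p x.2) | x <- items (sent_to q) (src p)]
    | p <- enum P]).

Lemma eq_arrivals q src src' : src =1 src' -> arrivals q src = arrivals q src'.
Proof.
move=> ss; rewrite /arrivals; congr (sort _ (flatten _)).
by apply: eq_map => p; rewrite ss.
Qed.

Lemma arrivals_windowed q src k : (forall p, windowed D k (src p)) ->
  windowed D k.+1 (arrivals q src).
Proof.
move=> srcw; rewrite /windowed (sort_sorted (@tle_total _ _)) all_sort /=.
elim: (enum P) => //= p s; rewrite all_cat => ->; rewrite andbT all_map.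
have /andP[_] := srcw p => /(all_items (sent_to q) (P := in_window D k)).
have shift n : n.+1%:R * D = n%:R * D + D by rewrite -natr1 mulrDl mul1r.
apply: sub_all => x /andP[lo hi].
by apply/andP; split; rewrite shift ?lerD2r ?ltrD2r.
Qed.

Lemma arrivals_accepted q src : all (fun x => accepted q x.2) (arrivals q src).
Proof.
rewrite all_sort; elim: (enum P) => //= p s; rewrite all_cat => ->.
by rewrite all_map andbT (@eq_all _ _ predT) ?all_predT.
Qed.

(** A constant delay preserves the order of the messages of [p], and so does the stable merge with
    those of other senders: this is the FIFO property. *)
Lemma received_arrivals p q src : sorted tle (src p) ->
  items (received_from p) (arrivals q src) =
  [seq (x.1 + D, x.2) | x <- items (sent_to q) (src p)].
Proof.
move=> sp; pose F p' :=
  [seq (x.1 + D, Recv p' x.2 : inp) | x <- items (sent_to q) (src p')].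
pose a (x : R * inp) := ~~ nilp (received_from p x.2).
have aF p' : p' != p -> [seq x <- F p' | a x] = [::].
  move=> /negPf p'p; rewrite /F; elim: (items _ _) => //= x l ->.
  by rewrite /a /= p'p.
have aFp : [seq x <- F p | a x] = F p.
  rewrite /F; elim: (items _ _) => //= x l ->.
  by rewrite /a /= eqxx.
have pick : [seq x <- flatten [seq F p' | p' <- enum P] | a x] = F p.
  by rewrite (filter_flatten_pick aF).
rewrite /arrivals items_sort -/F; rewrite ?pick; last first.
  rewrite /F sorted_map; apply: sub_sorted (sorted_items _ sp) => x y /=.
  by rewrite /tle /= lerD2r.
rewrite -(@items_filter _ _ _ _ a) ?pick => [|x]; last by rewrite negbK => /nilP.
rewrite /F; elim: (items (sent_to q) (src p)) => //= x l IH.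
by rewrite items_cons /= eqxx /= IH.
Qed.

(** * Construction of a run by recursion on windows *)

Section Run.
Variables (ini : P -> lstate) (requests : P -> seq (R * inp)).
(* [override k q p = Some l]: what [q] receives from [p] in window [k.+1] is
   what [p] would have sent in window [k] by taking the steps [l]. *)
Variable override : nat -> P -> P -> option (seq (R * act)).

Definition source (prev : P -> seq (R * act)) (k : nat) (q p : P) :=
  odflt (prev p) (override k q p).

(** The state is that at time [k%:R * D], before the steps of window [k]. Requests enter in window 0
    only, where nothing can have arrived yet. *)
Fixpoint run (k : nat) (q : P) : lstate * seq (R * act) :=
  if k is k'.+1 then
    let s := foldl (next_state q) (run k' q).1 (run k' q).2 in
    (s, run_on q (k'.+2%:R * D) (k'.+1%:R * D) s
          (arrivals q (source (fun p => (run k' p).2) k' q)))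
  else (ini q, run_on q (1%:R * D) (0%:R * D) (ini q) (requests q)).

Definition run_steps (k : nat) (q : P) := (run k q).2.

Lemma run_stepsS k q : run_steps k.+1 q =
  run_on q (k.+2%:R * D) (k.+1%:R * D)
    (foldl (next_state q) (run k q).1 (run_steps k q))
    (arrivals q (source (run_steps k) k q)).
Proof. by []. Qed.

Definition run_inputs (k : nat) (q : P) :=
  if k is k'.+1 then arrivals q (source (run_steps k') k' q) else requests q.

Hypothesis requests_windowed : forall q, windowed D 0 (requests q).
Hypothesis requests_accepted : forall q, all (fun x => accepted q x.2) (requests q).
Hypothesis override_windowed :
  forall k q p l, override k q p = Some l -> windowed D k l.

Lemma run_on_spec p k s arr : windowed D k arr ->
  all (fun x => accepted p x.2) arr ->
  let l := run_on p (k.+1%:R * D) (k%:R * D) s arr in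
  local_run p (k.+1%:R * D) (k%:R * D) s l /\ external l = arr.
Proof.
move=> /andP[sarr warr] acc /=; apply: (epsilon_spec (inhabits [::])
  (fun l => local_run _ _ _ _ l /\ external l = arr)).
apply: local_run_exists.
- by rewrite ltr_pM2r // ltr_nat.
- rewrite path_sortedE; last exact: le_trans.
  rewrite all_map sorted_map sarr andbT.
  by apply: sub_all warr => x /andP[].
- elim: arr warr acc {sarr} => //= x arr IH /andP[/andP[_ ->] wa] /andP[-> ac].
  exact: IH.
Qed.

Lemma local_run_in_window p k s l :
  local_run p (k.+1%:R * D) (k%:R * D) s l -> windowed D k l.
Proof. by move=> /local_run_windowed[sl wl _]; apply/andP. Qed.

Lemma run_spec k q :
  local_run q (k.+1%:R * D) (k%:R * D) (run k q).1 (run_steps k q) /\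
  external (run_steps k q) = run_inputs k q.
Proof.
elim: k q => [|k IH] q.
  exact: (run_on_spec (ini q) (requests_windowed q) (requests_accepted q)).
apply: (run_on_spec _ _ (arrivals_accepted _ _)).
apply: arrivals_windowed => p; rewrite /source.
case E: (override k q p) => [l|] /=; first exact: override_windowed E.
exact: local_run_in_window (IH p).1.
Qed.

Lemma run_windowed k q : windowed D k (run_steps k q).
Proof. exact: local_run_in_window (run_spec k q).1. Qed.

Lemma run_actor k q : all (fun x => actor x.2 == q) (run_steps k q).
Proof. by have [/local_run_windowed[]] := run_spec k q. Qed.

Lemma run_runs_locally q : runs_locally run_steps ini q.
Proof.
move=> k; suff <- : (run k q).1 =
  foldl (next_state q) (ini q) (first_windows (run_steps^~ q) k).
  exact: (run_spec k q).1.
by elim: k => // k IH; rewrite first_windowsS foldl_cat -IH.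
Qed.

Lemma source_windowed k q p : windowed D k (source (run_steps k) k q p).
Proof.
rewrite /source; case E: (override k q p) => [l|] /=.
  exact: override_windowed E.
exact: run_windowed.
Qed.

Lemma run_received0 p q :
  all (fun x => ~~ nilp (broadcast_in x.2)) (requests q) ->
  items (received_from p \o @act_in _ _ _ _ A) (run_steps 0 q) = [::].
Proof.
move=> req; rewrite items_external // (run_spec 0 q).2 items_nil //.
by apply: sub_all req => -[t []].
Qed.

Lemma run_receivedS p q k :
  items (received_from p \o @act_in _ _ _ _ A) (run_steps k.+1 q) =
  [seq (x.1 + D, x.2) | x <- items (sent_to q) (source (run_steps k) k q p)].
Proof.
rewrite items_external // (run_spec k.+1 q).2 received_arrivals //.
by case/andP: (source_windowed k q p).
Qed.

Lemma run_broadcastsS q k :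
  items (broadcast_in \o @act_in _ _ _ _ A) (run_steps k.+1 q) = [::].
Proof.
rewrite items_external // (run_spec k.+1 q).2 items_nil // all_sort.
elim: (enum P) => //= p s; rewrite all_cat => ->.
by rewrite all_map andbT (@eq_all _ _ predT) ?all_predT.
Qed.

Lemma run_broadcasts0 q :
  items (broadcast_in \o @act_in _ _ _ _ A) (run_steps 0 q) =
  items broadcast_in (requests q).
Proof. by rewrite items_external // (run_spec 0 q).2. Qed.

End Run.

(** * Faulty processes following a script *)

Section Puppet.
Variables (z : P) (arr : seq (R * inp)) (outs : seq (R * seq (P * msg))).

(* A faulty process that receives [arr] and independently sends [outs]. *)
Definition puppet : seq (R * act) :=
  sort tle ([seq (x.1, Action z x.2 (Output [::] [::])) | x <- arr] ++
            [seq (x.1, Action z Wake (Output x.2 [::])) | x <- outs]).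

Lemma puppet_windowed k : windowed D k arr ->
  all (fun x => in_window D k x.1) outs -> windowed D k puppet.
Proof.
move=> /andP[_ wa] wo.
by rewrite /windowed (sort_sorted (@tle_total _ _)) all_sort all_cat !all_map wa.
Qed.

Lemma puppet_actor : all (fun x => actor x.2 == z) puppet.
Proof.
rewrite all_sort all_cat !all_map.
by rewrite !(@eq_all _ _ predT) ?all_predT // => x /=; rewrite eqxx.
Qed.

(** The scripted sends are attached to [Wake] inputs, which receive nothing, so they leave the
    receptions untouched. *)
Lemma puppet_received p : sorted tle arr ->
  items (received_from p \o @act_in _ _ _ _ A) puppet =
  items (received_from p) arr.
Proof.
move=> sa; rewrite items_sort.
  rewrite items_cat (items_map (fun x => Action z x (Output [::] [::]))).
  by rewrite [X in _ ++ X]items_nil ?cats0 // all_map (@eq_all _ _ predT) ?all_predT.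
rewrite filter_cat; set o := (X in _ ++ X).
have -> : o = [::] by rewrite /o; elim: outs.
rewrite cats0; apply: (sorted_filter (@tle_trans _ _)).
by rewrite sorted_map.
Qed.

Definition addressed_to (q : P) (l : seq (P * msg)) : seq msg :=
  [seq u.2 | u <- l & u.1 == q].

(** Only the entries that concern [q] have to be sorted, because [client_outs] concatenates two
    scripts with disjoint destinations and is not sorted as a whole. *)
Lemma puppet_sent q : sorted tle [seq x <- outs | ~~ nilp (addressed_to q x.2)] ->
  items (sent_to q) puppet = items (addressed_to q) outs.
Proof.
move=> so; rewrite items_sort.
  rewrite items_cat (items_map (fun l => Action z Wake (Output l [::]))).
  by rewrite items_nil // all_map (@eq_all _ _ predT) ?all_predT.
rewrite filter_cat; set o := (X in X ++ _).
have -> : o = [::] by rewrite /o; elim: arr.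
by rewrite filter_map sorted_map.
Qed.

End Puppet.

(** * The three indistinguishable executions *)

Section Forgery.
Variables (ini : P -> lstate) (theta s1 : P) (m : M) (f : nat).
Hypothesis ini_init : forall p, alg_init p (ini p).
Hypothesis theta_client : theta \in Theta.
Hypothesis s1_theta : s1 != theta.
Hypothesis f_gt0 : (0 < f)%N.

Notation recvs := (@act_in _ _ _ _ A).

Definition good_steps : nat -> P -> seq (R * act) :=
  run_steps ini (fun q => if q == theta then [:: (0, Bcast m)] else [::])
    (fun _ _ _ => None).

Lemma good_requests_windowed q :
  windowed D 0 (if q == theta then [:: (0, Bcast m : inp)] else [::]).
Proof.
by case: eqP => // _; rewrite /windowed /= /in_window mul0r lexx mul1r D_gt0.
Qed.

Lemma good_requests_accepted q :
  all (fun x => accepted q x.2)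
    (if q == theta then [:: (0 : R, Bcast m : inp)] else [::]).
Proof. by case: eqP => //= ->; rewrite theta_client. Qed.

Lemma no_override_windowed (k : nat) (q p : P) (l : seq (R * act)) :
  None = Some l -> windowed D k l.
Proof. by []. Qed.

Lemma good_windowed k q : windowed D k (good_steps k q).
Proof.
exact: (run_windowed ini good_requests_windowed good_requests_accepted
  no_override_windowed).
Qed.

Lemma good_actor k q : all (fun x => actor x.2 == q) (good_steps k q).
Proof.
exact: (run_actor ini good_requests_windowed good_requests_accepted
  no_override_windowed).
Qed.

(* Nobody broadcasts, but [s1] receives in window 1 what [theta] would have
   sent in window 0 while broadcasting, and then nothing more from [theta]. *)
Definition forged_link (k : nat) (q p : P) : option (seq (R * act)) :=
  if (q == s1) && (p == theta) then
    Some (if k is 0%N then good_steps 0 theta else [::])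
  else None.

Definition forged_steps : nat -> P -> seq (R * act) :=
  run_steps ini (fun _ => [::]) forged_link.

Lemma forged_link_windowed k q p l : forged_link k q p = Some l -> windowed D k l.
Proof.
rewrite /forged_link; case: ifP => // _ [<-].
by case: k => //; exact: good_windowed.
Qed.

Lemma no_requests_windowed (q : P) : windowed D 0 ([::] : seq (R * inp)).
Proof. by []. Qed.

Lemma no_requests_accepted (q : P) :
  all (fun x => accepted q x.2) ([::] : seq (R * inp)).
Proof. by []. Qed.

Lemma forged_windowed k q : windowed D k (forged_steps k q).
Proof.
exact: (run_windowed ini no_requests_windowed no_requests_accepted
  forged_link_windowed).
Qed.

Lemma forged_receivedS p q k :
  items (received_from p \o recvs) (forged_steps k.+1 q) =
  [seq (x.1 + D, x.2)
     | x <- items (sent_to q) (source forged_link (forged_steps k) k q p)].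
Proof.
exact: (run_receivedS ini no_requests_windowed no_requests_accepted
  forged_link_windowed).
Qed.

Lemma forged_received0 p q :
  items (received_from p \o recvs) (forged_steps 0 q) = [::].
Proof.
by rewrite (run_received0 ini no_requests_windowed no_requests_accepted
  forged_link_windowed).
Qed.

Lemma forged_broadcasts k q :
  items (broadcast_in \o recvs) (forged_steps k q) = [::].
Proof.
case: k => [|k].
  exact: (run_broadcasts0 ini no_requests_windowed no_requests_accepted
    forged_link_windowed).
exact: (run_broadcastsS ini no_requests_windowed no_requests_accepted
  forged_link_windowed).
Qed.

(** No message arrives in window 0, so only the process that is asked to broadcast can behave
    differently there. *)
Lemma good_steps0 p : p != theta -> good_steps 0 p = forged_steps 0 p.
Proof. by move=> /negPf pt; rewrite /good_steps /forged_steps /run_steps /= pt. Qed.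

(* Until time [2 * D], [s1] cannot tell whether [theta] did broadcast. *)
Lemma good_steps1 : good_steps 1 s1 = forged_steps 1 s1.
Proof.
rewrite /good_steps /forged_steps !run_stepsS /=.
rewrite -!/good_steps -!/forged_steps (good_steps0 s1_theta); congr run_on.
(* From [theta], the substituted link carries precisely what the good run sends; the other senders
   act alike in window 0. *)
apply: eq_arrivals => p; rewrite /source /forged_link eqxx /=.
by case: eqP => [->|/eqP/good_steps0].
Qed.

Definition outs_to (a : pred P) (l : seq (R * act)) : seq (R * seq (P * msg)) :=
  [seq (e.1, [seq u <- sends (act_out e.2) | a u.1]) | e <- l].

(* [theta] is faulty: it talks to [s1] as if it had broadcast. *)
Definition client_outs (k : nat) : seq (R * seq (P * msg)) :=
  outs_to (fun p => p != s1) (forged_steps k theta) ++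
  (if k is 0%N then outs_to (fun p => p == s1) (good_steps 0 theta) else [::]).

(** Arrivals without any substitution. Links are reliable at faulty processes too, so a faulty
    [theta] or [s1] has to receive exactly these. *)
Definition forged_arrivals (k : nat) (q : P) : seq (R * inp) :=
  if k is k'.+1 then arrivals q (forged_steps k') else [::].

Definition faulty_client_steps (k : nat) (p : P) : seq (R * act) :=
  if p == theta then puppet theta (forged_arrivals k theta) (client_outs k)
  else forged_steps k p.

(* [s1] is faulty: it pretends to receive what it received in the previous
   scenario. *)
Definition faulty_server_steps (k : nat) (p : P) : seq (R * act) :=
  if p == s1 then puppet s1 (forged_arrivals k s1)
      [seq (e.1, sends (act_out e.2)) | e <- forged_steps k s1]
  else forged_steps k p.

Lemma forged_arrivals_windowed k q : windowed D k (forged_arrivals k q).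
Proof. by case: k => // k; apply: arrivals_windowed => p; exact: forged_windowed. Qed.

Lemma received_forged_arrivals p q k :
  items (received_from p) (forged_arrivals k.+1 q) =
  [seq (x.1 + D, x.2) | x <- items (sent_to q) (forged_steps k p)].
Proof. by rewrite received_arrivals //; case/andP: (forged_windowed k p). Qed.

Lemma outs_to_nil (a : pred P) q l : ~~ a q ->
  all (fun x => nilp (addressed_to q x.2)) (outs_to a l).
Proof.
move=> /negPf aq; rewrite all_map (@eq_all _ _ predT) ?all_predT // => e /=.
rewrite /addressed_to -filter_predI (@eq_filter _ _ pred0) ?filter_pred0 // => u /=.
by case: eqP => // ->; rewrite aq.
Qed.

Lemma items_outs_to (a : pred P) q l : a q ->
  items (addressed_to q) (outs_to a l) = items (sent_to q) l.
Proof.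
move=> aq; rewrite (items_map (fun e => [seq u <- sends (act_out e) | a u.1])).
apply: eq_items => e; rewrite /= /addressed_to /sent_to -filter_predI.
by congr map; apply: eq_filter => u /=; case: eqP => // ->; rewrite aq.
Qed.

Lemma sorted_outs_to (a : pred P) l : sorted tle l -> sorted tle (outs_to a l).
Proof. by rewrite sorted_map. Qed.

Lemma filter_all0 T (a : pred T) l :
  all (fun x => a x) l -> [seq x <- l | ~~ a x] = [::].
Proof. by elim: l => //= x l IH /andP[-> /IH]. Qed.

(** The messages that [forged_link] substitutes are thus really sent by the faulty [theta], so the
    links of this scenario behave correctly. *)
Lemma faulty_client_sent p q k :
  items (sent_to q) (faulty_client_steps k p) =
  items (sent_to q) (source forged_link (forged_steps k) k q p).
Proof.
rewrite /faulty_client_steps /source /forged_link.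
case: eqP => [->|_]; last by rewrite andbF.
have /andP[sf _] := forged_windowed k theta.
have /andP[sg _] := good_windowed 0 theta.
rewrite andbT puppet_sent; last first.
  rewrite filter_cat; case: (eqVneq q s1) => [->|qs].
    rewrite filter_all0 ?outs_to_nil ?eqxx //=.
    case: k {sf} => //; apply: (sorted_filter (@tle_trans _ _)).
    exact: sorted_outs_to.
  rewrite [X in _ ++ X]filter_all0 ?cats0; last first.
    by case: k {sf} => //; rewrite outs_to_nil.
  by apply: (sorted_filter (@tle_trans _ _)); exact: sorted_outs_to.
rewrite items_cat; case: (eqVneq q s1) => [->|qs] /=.
  rewrite items_nil ?outs_to_nil ?eqxx //=.
  by case: k {sf} => //; rewrite items_outs_to.
rewrite items_outs_to // [X in _ ++ X]items_nil ?cats0 //.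
by case: k {sf} => //; rewrite outs_to_nil.
Qed.

(** Whatever [s1] really receives, it sends as if the forged messages had come, so the other
    processes see no difference. *)
Lemma faulty_server_sent p q k :
  items (sent_to q) (faulty_server_steps k p) = items (sent_to q) (forged_steps k p).
Proof.
rewrite /faulty_server_steps; case: eqP => // ->.
have /andP[sf _] := forged_windowed k s1.
rewrite puppet_sent; last first.
  by apply: (sorted_filter (@tle_trans _ _)); rewrite sorted_map.
by rewrite (items_map (fun e => sends (act_out e))).
Qed.

Lemma puppet_steps_windowed z outs k :
  all (fun x => in_window D k x.1) outs ->
  windowed D k (puppet z (forged_arrivals k z) outs).
Proof. by move=> wo; apply: puppet_windowed => //; exact: forged_arrivals_windowed. Qed.

Lemma faulty_client_windowed k p : windowed D k (faulty_client_steps k p).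
Proof.
rewrite /faulty_client_steps; case: eqP => _; last exact: forged_windowed.
apply: puppet_steps_windowed; rewrite all_cat all_map.
have /andP[_ ->] /= := forged_windowed k theta.
by case: k => //; rewrite all_map; have /andP[_ ->] := good_windowed 0 theta.
Qed.

Lemma faulty_server_windowed k p : windowed D k (faulty_server_steps k p).
Proof.
rewrite /faulty_server_steps; case: eqP => _; last exact: forged_windowed.
apply: puppet_steps_windowed; rewrite all_map.
by have /andP[_ ->] := forged_windowed k s1.
Qed.

Lemma forged_actor k q : all (fun x => actor x.2 == q) (forged_steps k q).
Proof.
exact: (run_actor ini no_requests_windowed no_requests_accepted
  forged_link_windowed).
Qed.

Lemma faulty_client_actor k p : all (fun x => actor x.2 == p) (faulty_client_steps k p).
Proof.
rewrite /faulty_client_steps; case: eqP => [->|_]; first exact: puppet_actor.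
exact: forged_actor.
Qed.

Lemma faulty_server_actor k p : all (fun x => actor x.2 == p) (faulty_server_steps k p).
Proof.
rewrite /faulty_server_steps; case: eqP => [->|_]; first exact: puppet_actor.
exact: forged_actor.
Qed.

Lemma puppet_forged_received0 p z outs :
  items (received_from p \o recvs) (puppet z (forged_arrivals 0 z) outs) = [::].
Proof. by rewrite puppet_received. Qed.

Lemma puppet_forged_receivedS p z outs k :
  items (received_from p \o recvs) (puppet z (forged_arrivals k.+1 z) outs) =
  [seq (x.1 + D, x.2) | x <- items (sent_to z) (forged_steps k p)].
Proof.
rewrite puppet_received ?received_forged_arrivals //.
by case/andP: (forged_arrivals_windowed k.+1 z).
Qed.

(** * The traces of the three scenarios and the contradiction *)

Notation good_trace := (hist_trace good_steps set0 ini).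
Notation faulty_client_trace := (hist_trace faulty_client_steps [set theta] ini).
Notation faulty_server_trace := (hist_trace faulty_server_steps [set s1] ini).

Lemma good_trace_good : good_case Pi good_trace f D.
Proof.
have w := good_windowed; have a := good_actor.
have lr p : p \notin set0 -> runs_locally good_steps ini p.
  move=> _; exact: (run_runs_locally ini good_requests_windowed
    good_requests_accepted no_override_windowed).
split=> //.
- apply: (hist_base w a) => [|p p0]; first by rewrite set0I cards0.
  split=> [||[|k]]; [exact: ini_init|exact: lr| |].
    rewrite (run_broadcasts0 ini good_requests_windowed
      good_requests_accepted no_override_windowed).
    by case: eqP.
  by rewrite (run_broadcastsS ini good_requests_windowed
    good_requests_accepted no_override_windowed).
- apply: (hist_links _ _ w a) => [p q|p q k].
    apply: (run_received0 ini good_requests_windowed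
      good_requests_accepted no_override_windowed).
    by case: eqP.
  exact: (run_receivedS ini good_requests_windowed
    good_requests_accepted no_override_windowed).
- exact: (hist_steps w a (lexx 0) lr).
- exact: hist_clocks.
Qed.

Lemma singleton_faulty (z : P) : (#|[set z] :&: Pi| <= f)%N.
Proof.
apply: leq_trans f_gt0; rewrite -(cards1 z); apply: subset_leq_card; exact: subsetIl.
Qed.

Lemma eq_runs_locally (h h' : nat -> P -> seq (R * act)) p :
  (forall k, h k p = h' k p) -> runs_locally h ini p -> runs_locally h' ini p.
Proof.
move=> hh lr k; rewrite -hh.
suff <- : first_windows (h^~ p) k = first_windows (h'^~ p) k by [].
by rewrite /first_windows; congr flatten; apply: eq_map.
Qed.

Lemma faulty_client_execution : execution Pi faulty_client_trace f D 0.
Proof.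
have lr p : p \notin [set theta] -> runs_locally faulty_client_steps ini p.
  rewrite inE => /negPf pt; apply: (@eq_runs_locally forged_steps) => [k|].
    by rewrite /faulty_client_steps pt.
  exact: (run_runs_locally ini no_requests_windowed no_requests_accepted
    forged_link_windowed).
split; last exact: hist_clocks.
- apply: (hist_base faulty_client_windowed faulty_client_actor) => [|p pt].
    exact: singleton_faulty.
  split=> [||k]; [exact: ini_init|exact: lr|].
  move: pt; rewrite inE => /negPf pt.
  by rewrite /faulty_client_steps pt forged_broadcasts.
- apply: (hist_links _ _ faulty_client_windowed faulty_client_actor) => [p q|p q k].
    rewrite {1}/faulty_client_steps; case: eqP => _.
      exact: puppet_forged_received0.
    exact: forged_received0.
  rewrite faulty_client_sent {1}/faulty_client_steps.
  case: eqP => [->|_]; last exact: forged_receivedS.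
  (* The only receiver with a substituted link is [s1], so the faulty [theta] gets genuine
     messages. *)
  by rewrite puppet_forged_receivedS /source /forged_link eq_sym (negPf s1_theta).
- exact: (hist_steps faulty_client_windowed faulty_client_actor (ltW D_gt0) lr).
Qed.

Lemma faulty_server_execution : execution Pi faulty_server_trace f D 0.
Proof.
have lr p : p \notin [set s1] -> runs_locally faulty_server_steps ini p.
  rewrite inE => /negPf pt; apply: (@eq_runs_locally forged_steps) => [k|].
    by rewrite /faulty_server_steps pt.
  exact: (run_runs_locally ini no_requests_windowed no_requests_accepted
    forged_link_windowed).
split; last exact: hist_clocks.
- apply: (hist_base faulty_server_windowed faulty_server_actor) => [|p pt].
    exact: singleton_faulty.
  split=> [||k]; [exact: ini_init|exact: lr|].
  move: pt; rewrite inE => /negPf pt.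
  by rewrite /faulty_server_steps pt forged_broadcasts.
- apply: (hist_links _ _ faulty_server_windowed faulty_server_actor) => [p q|p q k].
    rewrite {1}/faulty_server_steps; case: eqP => _.
      exact: puppet_forged_received0.
    exact: forged_received0.
  rewrite faulty_server_sent {1}/faulty_server_steps.
  case: eqP => [->|/eqP/negPf qs]; first exact: puppet_forged_receivedS.
  by rewrite forged_receivedS /source /forged_link qs.
- exact: (hist_steps faulty_server_windowed faulty_server_actor (ltW D_gt0) lr).
Qed.

Lemma forgery_contradiction (T : R) (s2 : P) :
  s1 \in Pi -> s2 \in Pi -> s2 != s1 -> s2 != theta -> T < 2%:R * D ->
  tob_implementation Pi f A -> T_bounded Pi f D T A -> False.
Proof.
move=> s1Pi s2Pi s21 s2t T_lt tob bounded.
pose c : client Theta := exist _ theta theta_client.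
have [i ti bi] :
    exists2 i, time good_trace i = 0 & takes good_trace i theta (Bcast m).
  apply: (broadcast_time _ _ good_windowed good_actor).
  rewrite (run_broadcasts0 ini good_requests_windowed
    good_requests_accepted no_override_windowed) eqxx.
  by rewrite /items /= inE.
have [|j tj dj] := bounded _ good_trace_good c m 0 _ s1 s1Pi.
  by exists i; rewrite ?ti.
(* Because [T < 2%:R * D], the delivery falls in windows 0 and 1, where [s1] takes the same steps in
   the good run and with the faulty client. *)
have {tj dj} d1 : (c, m) \in delivered faulty_client_trace s1
    (size (first_windows (window faulty_client_steps) 2)).
  have jlt : (j < size (first_windows (window good_steps) 2))%N.
    apply: (item_lt_start D_gt0 (window_windowed good_windowed) (window_head _)).
    by apply: le_lt_trans tj _; rewrite add0r.
  have := delivered_le_start jlt dj.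
  rewrite (delivered_start _ _ good_windowed good_actor).
  rewrite (delivered_start _ _ faulty_client_windowed faulty_client_actor) /=.
  by rewrite /faulty_client_steps (negPf s1_theta) good_steps0 // good_steps1.
have [_ _ _ agree] := tob _ _ _ faulty_client_execution.
(* Only [theta] is faulty here, so agreement forces [s2] to deliver [m] as well. *)
have [||k] := agree s1 s2 s1Pi s2Pi _ _
    (size (first_windows (window faulty_client_steps) 2)).
- by rewrite /correct inE.
- by rewrite /correct inE.
move=> /prefixP[r Er].
have d2 : (c, m) \in delivered faulty_client_trace s2
    (size (first_windows (window faulty_client_steps) k)).
  apply: (delivered_le_start (leq_start D_gt0 (window_head _) k)).
  by rewrite Er mem_cat d1.
move: d2; rewrite (delivered_start _ _ faulty_client_windowed faulty_client_actor) => d2.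
(* With [s1] faulty instead, [s2] has the same history and delivers [m], but now [theta] is correct
   and integrity requires a broadcast. *)
have [_ integ _ _] := tob _ _ _ faulty_server_execution.
have [|||l _] := integ s2 s2Pi _ c m
  (size (first_windows (window faulty_server_steps) k)).
- by rewrite /correct inE.
- by rewrite /correct inE eq_sym.
- rewrite (delivered_start _ _ faulty_server_windowed faulty_server_actor).
  move: d2; congr (_ \in flatten _); apply: eq_map => n.
  by rewrite /faulty_client_steps /faulty_server_steps (negPf s2t) (negPf s21).
apply: (no_broadcast faulty_server_windowed faulty_server_actor) => n.
by rewrite /faulty_server_steps eq_sym (negPf s1_theta) forged_broadcasts.
Qed.

End Forgery.
End Histories.

Theorem theorem11 (R : realType) (P : finType) (Pi Theta : {set P}) (M : eqType)
    (f : nat) (Delta T : R)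
    (processes : Pi :|: Theta = [set: P])
    (some_client : Theta != set0)
    (some_message : inhabited M)
    (f_gt0 : (0 < f)%N)
    (card_servers : #|Pi| = (5 * f + 1)%N)
    (Delta_gt0 : 0 < Delta)
    (T_lt : T < 2%:R * Delta) :
  ~ exists A : algorithm R Theta M,
      tob_implementation Pi f A /\ T_bounded Pi f Delta T A.
Proof.
case=> A [tob bounded]; case: some_message => m.
have [theta theta_client] := set0Pn _ some_client.
have card_remove (B : {set P}) x : (#|B| <= #|B :\ x|.+1)%N.
  by rewrite (cardsD1 x B); case: (x \in B); rewrite ?add1n // add0n leqnSn.
(* The client [theta] may itself be a server. As [f > 0], there are at least six servers, enough to
   pick [s1] and [s2] distinct from it and from each other. *)
have c1 := card_remove Pi theta.
have /set0Pn[s1] : Pi :\ theta != set0 by rewrite -card_gt0; lia.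
rewrite !inE => /andP[s1t s1Pi].
have c2 := card_remove (Pi :\ theta) s1.
have /set0Pn[s2] : Pi :\ theta :\ s1 != set0 by rewrite -card_gt0; lia.
rewrite !inE => /and3P[s21 s2t s2Pi].
(* One choice of initial states is shared by all scenarios, random tapes included; otherwise they
   could be told apart from the start. *)
pose ini p := proj1_sig (constructive_indefinite_description _ (alg_init_ex A p)).
have ini_init p : alg_init p (ini p) by exact: proj2_sig.
exact: (forgery_contradiction Delta_gt0 m ini_init theta_client s1t f_gt0
  s1Pi s2Pi s21 s2t T_lt tob bounded).
Qed.
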